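(* Let $1\leq p<\infty$, let $X,Y,Z$ be Banach spaces, let $U$ be a subspace of $\mathcal{UM}(X^*,Y)$ and let $S:U\to Z$ be an operator. Consider the following statements: (i) $S$ is $(\ell^s_p,\ell_p)$-controlled. (ii) $S$ is $(\ell^s_p,\ell_p)$-summing and (SOT-to-norm) sequentially continuous. Then (i) implies (ii). Moreover, (i) and (ii) are equivalent whenever $U\cap X\epsilon Y$ is SOT-sequentially dense in $U$.
   Context: All Banach spaces are real. ''Subspace'' of a Banach space means norm-closed linear subspace; ''operator'' means continuous linear map between Banach spaces. $B_{X^*}$ is the closed unit ball of the dual $X^*$, equipped with the weak$^*$-topology (a compact space), and $P(B_{X^*})$ is the set of regular Borel probability measures on $(B_{X^*},w^* )$. $\mathcal{L}(X^*,Y)$ is the Banach space of all operators from $X^*$ to $Y$ with the operator norm. $X\epsilon Y$ is the subspace of all $T\in\mathcal{L}(X^*,Y)$ whose restriction $T|_{B_{X^*}}$ is ($w^*$-to-norm) continuous. $\mathcal{UM}(X^*,Y)$ is the subspace of all $T\in\mathcal{L}(X^*,Y)$ such that $T|_{B_{X^*}}$ is universally strongly measurable, i.e. strongly $\mu$-measurable (a $\mu$-a.e. norm limit of a sequence of $\mu$-measurable simple functions) for every $\mu\in P(B_{X^*})$. The strong operator topology (SOT) on $\mathcal{L}(X^*,Y)$ is the topology of pointwise norm convergence: $T_\alpha\to 0$ in SOT iff $\|T_\alpha(x^* )\|_Y\to 0$ for every $x^*\in X^*$. A map is (SOT-to-norm) sequentially continuous if it sends SOT-convergent sequences (with limit in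 the domain) to sequences norm-converging to the image of the limit. A set $A\subseteq U$ is SOT-sequentially dense in $U$ if every element of $U$ is the SOT-limit of a sequence in $A$. For a subspace $U\subseteq\mathcal{L}(X^*,Y)$, an operator $S:U\to Z$ is $(\ell^s_p,\ell_p)$-summing if there is $K\geq 0$ such that $$\Big(\sum_{i=1}^n\|S(T_i)\|_Z^p\Big)^{1/p}\leq K\sup_{x^*\in B_{X^*}}\Big(\sum_{i=1}^n\|T_i(x^* )\|_Y^p\Big)^{1/p}$$ for all $n\in\mathbb{N}$ and $T_1,\dots,T_n\in U$. For a subspace $U\subseteq\mathcal{UM}(X^*,Y)$, an operator $S:U\to Z$ is $(\ell^s_p,\ell_p)$-controlled if there exist $K\geq 0$ and $\mu\in P(B_{X^*})$ such that $\|S(T)\|_Z\leq K\big(\int_{B_{X^*}}\|T(\cdot)\|_Y^p\,d\mu\big)^{1/p}$ for every $T\in U$. *)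

(* Defs.v *)
From HB Require Import structures.
From mathcomp Require Import all_boot all_order all_algebra.
From mathcomp Require Import all_classical all_reals all_analysis.
From mathcomp Require Import measurable_realfun.

Set Implicit Arguments.
Unset Strict Implicit.
Unset Printing Implicit Defensive.

Import Order.TTheory GRing.Theory Num.Theory.
Import numFieldNormedType.Exports.

Local Open Scope classical_set_scope.
Local Open Scope ring_scope.

Section operator.
Context (R : realType) (V W : normedModType R).

Definition is_operator : {pred V -> W} :=
  fun f => `[< linear f /\ continuous f >].

Record operator := Operator {
  operator_fun :> V -> W ;
  operator_subproof : operator_fun \in is_operator }.

HB.instance Definition _ := [isSub for operator_fun].
HB.instance Definition _ := [Choice of operator by <:].

Lemma is_operatorP (f : V -> W) :
  reflect (linear f /\ continuous f) (f \in is_operator).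
Proof. exact: asboolP. Qed.

Lemma is_operator_submod : submod_closed is_operator.
Proof.
split.
  apply/is_operatorP; split => [a x y|]; last exact: cst_continuous.
  by rewrite scaler0 addr0.
move=> a f g /is_operatorP[lf cf] /is_operatorP[lg cg].
apply/is_operatorP; split => [b x y|x].
  rewrite !fctE lf lg /= !scalerDr !scalerA (mulrC a b) -!addrA; congr (_ + _).
  by rewrite addrCA.
apply: (@continuousD R _ V (a *: f) g); last exact: cg.
by apply: (@continuousZl_tmp R _ V f a); exact: cf.
Qed.

HB.instance Definition _ := GRing.isSubmodClosed.Build R (V -> W) is_operator
  is_operator_submod.
HB.instance Definition _ := [SubChoice_isSubLmodule of operator by <:].

Lemma operatorP (f g : operator) : f = g <-> f =1 g.
Proof. by split=> [->//|fg]; exact/val_inj/funext. Qed.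

Lemma operator_linear (f : operator) : linear f.
Proof. by case: f => f /= /is_operatorP[]. Qed.

HB.instance Definition _ (f : operator) :=
  @GRing.isLinear.Build R V W _ f (operator_linear f).

Lemma operator_continuous (f : operator) : continuous f.
Proof. by case: f => f /= /is_operatorP[]. Qed.

Definition operator_norm (f : operator) : R :=
  sup [set `|f x| | x in [set x | `|x| <= 1]].

Lemma operator_norm_has_sup (f : operator) :
  has_sup [set `|f x| | x in [set x | `|x| <= 1]].
Proof.
split; first by exists `|f 0|, 0 => //=; rewrite normr0.
have /linear_boundedP/pinfty_ex_gt0[r r0 fr] :=
  @continuous_linear_bounded R V W 0 f (@operator_continuous f 0).
exists r => _ [x /= x1 <-]; rewrite (le_trans (fr x))//.
by rewrite ler_piMr// ltW.
Qed.

Lemma operator_norm_ub (f : operator) x : `|x| <= 1 -> `|f x| <= operator_norm f.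
Proof.
move=> x1; apply: (sup_upper_bound (operator_norm_has_sup f)).
by exists x.
Qed.

Lemma operator_norm_le (f : operator) r :
  (forall x, `|x| <= 1 -> `|f x| <= r) -> operator_norm f <= r.
Proof.
move=> fr; apply: ge_sup; first by case: (operator_norm_has_sup f).
by move=> _ [x /= x1 <-]; exact: fr.
Qed.

Lemma operator_norm_ge0 f : 0 <= operator_norm f.
Proof. by rewrite (le_trans _ (@operator_norm_ub f 0 _)) ?normr0. Qed.

Lemma operator_normD f g :
  operator_norm (f + g) <= operator_norm f + operator_norm g.
Proof.
apply: operator_norm_le => x x1; rewrite (le_trans (ler_normD (f x) (g x)))//.
by rewrite lerD// operator_norm_ub.
Qed.

Lemma operator_normZ (a : R) f :
  operator_norm (a *: f) = `|a| * operator_norm f.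
Proof.
have le b g : operator_norm (b *: g) <= `|b| * operator_norm g.
  apply: operator_norm_le => x x1.
  by rewrite -[leLHS]/(`|b *: g x|) normrZ ler_wpM2l// operator_norm_ub.
apply/eqP; rewrite eq_le le/=; have [->|a0] := eqVneq a 0.
  by rewrite normr0 mul0r operator_norm_ge0.
rewrite -ler_pdivlMl ?normr_gt0// -normfV.
by rewrite (le_trans _ (le _ _))// scalerA mulVf// scale1r.
Qed.

Lemma operator_norm_eq0 f : operator_norm f = 0 -> f = 0.
Proof.
move=> f0; apply/operatorP => x; apply/eqP; rewrite -normr_eq0.
have [->|x0] := eqVneq x 0; first by rewrite linear0 normr0.
have : `|f (`|x|^-1 *: x)| <= 0.
  by rewrite -f0 operator_norm_ub// normrZ normfV normr_id mulVf ?normr_eq0.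
rewrite linearZ/= normrZ normfV normr_id pmulr_rle0 ?invr_gt0 ?normr_gt0//.
by move=> fx0; apply/eqP/le_anti; rewrite fx0 normr_ge0.
Qed.

HB.instance Definition _ := @Lmodule_isNormed.Build R operator operator_norm
  operator_normD operator_normZ operator_norm_eq0.

End operator.

Definition dual (R : realType) (X : normedModType R) : normedModType R :=
  operator X R^o.

(* The coarsest topology on the dual that makes every evaluation continuous. *)
Definition weak_star (R : realType) (X : normedModType R) :=
  initial_topology (fun f : dual X => (f : X -> R) : {ptws X -> R}).
HB.instance Definition _ (R : realType) (X : normedModType R) :=
  Topological.on (weak_star X).

Lemma initial_cvg (S : choiceType) (T : topologicalType) (h : S -> T) (F : set_system S) (s : S) :
  Filter F -> (F --> (s : initial_topology h)) <-> h @ F --> h s.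
Proof.
move=> FF; split=> [Fs|hFs].
  by move=> A /(@initial_continuous S T h s) ?; exact: Fs.
move=> A [_ [[B oB <-] /= Bs sA]].
apply: filterS sA _; apply: hFs; exact: open_nbhs_nbhs.
Qed.

Definition dual_ball (R : realType) (X : normedModType R) : Type :=
  set_type [set f : weak_star X | `|f : dual X| <= 1].

Section dual_ball.
Context (R : realType) (X : normedModType R).

HB.instance Definition _ := Topological.on (dual_ball X).

Lemma dual_ball0_subproof :
  (0 : dual X) \in [set f : weak_star X | `|f : dual X| <= 1].
Proof. by rewrite inE /= normr0. Qed.

HB.instance Definition _ := isPointed.Build (dual_ball X)
  (exist _ (0 : dual X) dual_ball0_subproof).

Definition ball_val (f : dual_ball X) : dual X := set_val f.

End dual_ball.

Lemma dual_ball_cvgP (R : realType) (X : normedModType R)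
    (F : set_system (dual_ball X)) (f : dual_ball X) : Filter F ->
  F --> f <-> forall x, ball_val g x @[g --> F] --> (ball_val f x : R).
Proof.
move=> FF.
rewrite (@initial_cvg _ (weak_star X) set_val).
rewrite (@initial_cvg _ {ptws X -> R} (fun f : dual X => (f : X -> R))).
exact: (@pointwise_cvgP _ _ ((fun f : dual X => (f : X -> R)) @ (set_val @ F)) (ball_val f)).
Qed.

Definition borel (T : ptopologicalType) := g_sigma_algebraType (@open T).
HB.instance Definition _ (T : ptopologicalType) := Measurable.on (borel T).

Section completed_integral.
Import HBNNSimple.

(* Integrals of nonnegative functions that are only measurable for the
   completion of mu: the library's integral is defined for them as well. *)
Lemma ge0_completed_integralE d (T : measurableType d) (R : realType)
    (mu : {measure set T -> \bar R}) (f g : T -> \bar R) :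
  (forall x, 0 <= f x)%E -> (forall x, 0 <= g x)%E ->
  measurable_fun setT g -> {ae mu, forall x, f x = g x} ->
  (\int[mu]_x f x = \int[mu]_x g x)%E.
Proof.
move=> f0 g0 mg [N [mN N0 sN]].
have fgN x : x \notin N -> f x = g x.
  by move=> xN; apply: contrapT => fgx; move/negP: xN; apply; rewrite inE; exact: sN.
have mono (h k : T -> \bar R) : (forall x, 0 <= h x)%E ->
    (forall x, h x <= k x)%E -> (\int[mu]_x h x <= \int[mu]_x k x)%E.
  move=> h0 hk; rewrite !ge0_integralTE//; last first.
    by move=> x; exact: le_trans (h0 x) (hk x).
  apply: ereal_sup_le => _ [u /= uh <-].
  by exists u => // x; exact: le_trans (uh x) (hk x).
pose e (c : \bar R) x := if x \in N then c else g x.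
have e0 c : (0 <= c)%E -> forall x, (0 <= e c x)%E.
  by move=> c0 x; rewrite /e; case: ifPn.
have eg c : (0 <= c)%E -> (\int[mu]_x e c x = \int[mu]_x g x)%E.
  move=> c0; apply: ge0_ae_eq_integral => //.
  - apply: measurable_fun_ifT => //.
    apply: (@measurable_fun_bool _ _ _ _ true).
    by rewrite setTI (_ : _ @^-1` _ = N)//; apply/seteqP; split => x; [exact: set_mem|exact: mem_set].
  - by move=> x _; exact: e0.
  - exists N; split => // x /= h; apply: contrapT => xN; apply: h => _.
    by rewrite /e memNset.
apply/eqP; rewrite eq_le; apply/andP; split.
  rewrite -(eg +oo%E)//; apply: mono => // x; rewrite /e.
  by case: ifPn => [_|/fgN ->//]; rewrite leey.
rewrite -(eg 0%E)//; apply: mono => [|x]; first exact: e0.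
by rewrite /e; case: ifPn => [_|/fgN ->//].
Qed.

End completed_integral.

Section borel_measures.
Context (R : realType) (T : ptopologicalType).

Definition regular_measure (mu : {measure set (borel T) -> \bar R}) :=
  forall A : set (borel T), measurable A ->
    mu A = ereal_inf [set mu O | O in [set O : set T | open O /\ A `<=` O]] /\
    mu A = ereal_sup [set mu K | K in [set K : set T | compact K /\ K `<=` A]].

(* Strong measurability refers to the mu-completion of the Borel sets. *)
Definition mu_simple (Y : normedModType R)
    (mu : {measure set (borel T) -> \bar R}) (s : T -> Y) :=
  finite_set (range s) /\
  forall y, completed_algebra_gen mu (s @^-1` [set y]).

Definition strongly_measurable (Y : normedModType R)
    (mu : {measure set (borel T) -> \bar R}) (f : T -> Y) :=
  exists2 s : (T -> Y)^nat, (forall n, mu_simple mu (s n)) &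
    {ae mu, forall x, s n x @[n --> \oo] --> f x}.

End borel_measures.

Section operator_spaces.
Context {R : realType} (X Y : normedModType R).
Implicit Types (T : operator (dual X) Y) (U A : set (operator (dual X) Y)).

Definition epsilon_product : set (operator (dual X) Y) :=
  [set T | continuous (fun f : dual_ball X => T (ball_val f))].

Definition universally_measurable : set (operator (dual X) Y) :=
  [set T | forall mu : probability (borel (dual_ball X)) R, regular_measure mu ->
    strongly_measurable mu (fun f : dual_ball X => T (ball_val f))].

Definition sot_cvg (T_ : (operator (dual X) Y)^nat) T :=
  forall f : dual X, T_ n f @[n --> \oo] --> T f.

Definition sot_sequentially_dense A U :=
  A `<=` U /\
  forall T, U T ->
    exists2 T_ : (operator (dual X) Y)^nat, (forall n, A (T_ n)) & sot_cvg T_ T.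

Section operators_on_subspace.
Context (Z : normedModType R) (p : R) (U : set (operator (dual X) Y)).
Variable S : operator (dual X) Y -> Z.

Definition sot_sequentially_continuous :=
  forall (T_ : (operator (dual X) Y)^nat) T, (forall n, U (T_ n)) -> U T -> sot_cvg T_ T ->
    S (T_ n) @[n --> \oo] --> S T.

(* The set under sup is bounded since the T_ i are, and contains the value at 0. *)
Definition summing :=
  exists2 K : R, 0 <= K &
    forall n (T_ : 'I_n -> operator (dual X) Y), (forall i, U (T_ i)) ->
      (\sum_(i < n) `|S (T_ i)| `^ p) `^ p^-1 <=
      K * sup [set (\sum_(i < n) `|T_ i f| `^ p) `^ p^-1
              | f in [set f : dual X | `|f| <= 1]].

(* The integrand is only measurable for the completion of mu; the integral is
   nonetheless the one for the completion, see ge0_completed_integralE. *)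
Definition controlled :=
  exists2 K : R, 0 <= K &
    exists2 mu : probability (borel (dual_ball X)) R, regular_measure mu &
      forall T, U T ->
        (`|S T|%:E <= K%:E *
          (\int[mu]_(f in [set: borel (dual_ball X)])
             (`|T (ball_val f)| `^ p)%:E) `^ p^-1)%E.

End operators_on_subspace.
End operator_spaces.

Arguments epsilon_product {R} X Y.
Arguments universally_measurable {R} X Y.

Section closed_subspace.
Context (R : realType) (V W : normedModType R).

Definition closed_subspace (U : set V) :=
  [/\ closed U, U 0 & forall (a : R) x y, U x -> U y -> U (a *: x + y)].

(* Only the restriction of S to U matters. *)
Definition operator_on (U : set V) (S : V -> W) :=
  (forall (a : R) x y, U x -> U y -> S (a *: x + y) = a *: S x + S y) /\
  {within U, continuous S}.

End closed_subspace.

(* Main.v *)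
From HB Require Import structures.
Require Import Defs.
From mathcomp Require Import all_boot all_order all_algebra.
From mathcomp Require Import all_classical all_reals all_analysis.
From mathcomp Require Import measurable_realfun.
From mathcomp Require Import finmap.
From mathcomp Require Import ring lra.

(** For (i) => (ii), the integral of [|T_1 f|^p + .. + |T_n f|^p] against a
    probability on the dual ball is at most the supremum of that function, which
    gives the summing inequality ([controlled_summing]); a sequence converging
    in the strong operator topology is bounded on the ball by the
    Banach-Steinhaus theorem, so dominated convergence gives the sequential
    continuity ([controlled_sot_continuous]).

    For (ii) => (i), Pietsch's separation argument applies.  The functions
    [f |-> sum_i (|S T_i|^p - K^p |T_i f|^p)] on the dual ball form a convex
    cone, and the summing inequality says precisely that none of them is bounded
    below by a positive constant ([summing_pietsch_gap]).  By the Hahn-Banach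
    theorem a linear functional [L] on all bounded functions, dominated by the
    supremum, is nonpositive on that cone ([cone_separation]).  Restricted to
    indicators, [L] is a finitely additive probability on all subsets of the
    ball, which is compact and Hausdorff for the weak-star topology; from it a
    regular Borel probability [mu] is built that dominates it on closed sets
    ([regular_probability_ge]).  Slicing a nonnegative continuous function into
    superlevel sets shows that its integral against [mu] is at least its value
    under [L] ([functional_le_integral]), whence [|S T|^p] is at most [K^p]
    times the integral of [|T f|^p] when [T] in [U] is continuous on the ball
    ([summing_controlled_on_epsilon]).  Sequential density and continuity carry
    the inequality to all of [U] ([dense_summing_controlled]).

    For a general [T] in [U] the integrand [|T f|^p] is measurable only for the
    completion of [mu]; its integral is handled through a Borel function almost
    everywhere equal to it ([strongly_measurable_norm_powR]). *)

Set Implicit Arguments.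
Unset Strict Implicit.
Unset Printing Implicit Defensive.

Import Order.TTheory GRing.Theory Num.Theory.
Import numFieldNormedType.Exports.

Local Open Scope classical_set_scope.
Local Open Scope ring_scope.

(** * The Hahn-Banach theorem *)

Section hahn_banach.
Context (R : realType) (V : lmodType R).

Definition sublinear (q : V -> R) :=
  (forall x y, q (x + y) <= q x + q y) /\
  (forall (t : R) x, 0 < t -> q (t *: x) <= t * q x).

Lemma sublinear0 q : sublinear q -> q 0 = 0.
Proof.
move=> [qD qZ]; have half_gt0 : 0 < 2^-1 :> R by lra.
have := qZ 2^-1 0 half_gt0; have := qD 0 0; rewrite scaler0 addr0; lra.
Qed.

Lemma sublinear_ge q x : sublinear q -> - q (- x) <= q x.
Proof.
move=> sq; have [qD _] := sq.
by have := qD x (- x); rewrite subrr sublinear0//; lra.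
Qed.

(** Lower bounds exist because [q x] is at least [- q0 (- x)].  Subadditivity
    of the infimum uses that the family is a chain: given two members, the
    smaller one bounds both terms. *)
Lemma sublinear_inf (F : set (V -> R)) q0 : F q0 ->
  (forall q, F q -> sublinear q /\ forall x, q x <= q0 x) ->
  (forall q r, F q -> F r -> (forall x, q x <= r x) \/ (forall x, r x <= q x)) ->
  let r x := inf [set q x | q in F] in
  sublinear r /\ forall q x, F q -> r x <= q x.
Proof.
move=> Fq0 Fs Ft r.
have Fle q x : F q -> r x <= q x.
  move=> Fq; apply: ge_inf; last by exists q.
  exists (- q0 (- x)) => _ [q' Fq' <-].
  have [sq' q'0] := Fs _ Fq'.
  by rewrite (le_trans _ (sublinear_ge x sq'))// lerN2.
have Fge x a : (forall q, F q -> a <= q x) -> a <= r x.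
  move=> h; apply: lb_le_inf; first by exists (q0 x), q0.
  by move=> _ [q Fq <-]; exact: h.
split=> //; split=> [x y|t x t0].
  rewrite -lerBlDl; apply: (Fge) => q Fq; rewrite lerBlDl -lerBlDr.
  apply: (Fge) => q' Fq'; rewrite lerBlDr.
  have [[qD _] _] := Fs _ Fq; have [[qD' _] _] := Fs _ Fq'.
  have [le|le] := Ft _ _ Fq Fq'.
    by rewrite (le_trans (Fle _ _ Fq))// (le_trans (qD _ _))// lerD.
  by rewrite (le_trans (Fle _ _ Fq'))// (le_trans (qD' _ _))// lerD.
rewrite -ler_pdivrMl//; apply: (Fge) => q Fq; rewrite ler_pdivrMl//.
have [[_ qZ] _] := Fs _ Fq; exact: le_trans (Fle _ _ Fq) (qZ _ _ t0).
Qed.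

(** Zorn's lemma for the reversed pointwise order; the chain handed to
    [sublinear_inf] contains [q0], so that the empty chain is covered. *)
Lemma minimal_sublinear q0 : sublinear q0 ->
  exists q, [/\ sublinear q, forall x, q x <= q0 x &
    forall r, sublinear r -> (forall x, r x <= q x) -> forall x, r x = q x].
Proof.
move=> sq0.
pose Q (q : V -> R) := sublinear q /\ forall x, q x <= q0 x.
pose P := {q | Q q}.
pose le (q r : P) := `[< forall x, sval r x <= sval q x >].
have [||||[q [sq qq0]] qmax] := @Zorn P le.
- by move=> q; apply/asboolP.
- move=> r s t /asboolP rs /asboolP st; apply/asboolP => x.
  exact: le_trans (st x) (rs x).
- move=> [s Ps] [t Pt] /asboolP/= st /asboolP/= ts; apply: eq_exist.
  by apply/funext => x; apply/le_anti; rewrite st ts.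
- move=> A tA.
  pose F := [set q | q = q0 \/ exists2 u : P, A u & q = sval u].
  have Fq0 : F q0 by left.
  have [||sr Fr] := sublinear_inf Fq0.
  + by move=> _ [->//|[[q qP] _ ->]].
  + move=> _ _ [->|[u Au ->]] [->|[v Av ->]].
    * by left.
    * by right; case: v Av => v [].
    * by left; case: u Au => u [].
    * by have [/asboolP|/asboolP] := tA _ _ Au Av; [right|left].
  + have rP : Q (fun x => inf [set q x | q in F]) by split=> // x; exact: Fr.
    exists (exist Q _ rP) => u Au.
    by apply/asboolP => x /=; apply: Fr; right; exists u.
exists q; split=> // r sr rq x.
have rq0 y : r y <= q0 y by exact: le_trans (rq y) (qq0 y).
suff /(congr1 sval)/= <- :
  exist Q r (conj sr rq0) = exist Q q (conj sq qq0) by [].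
apply: qmax.
exact/asboolP.
Qed.

(** The Hahn-Banach theorem without extension of functionals: a minimal
    sublinear [q] is already linear.  Fix [y]; the infimum over [t >= 0] of
    [q (z + t y) - t q y] is sublinear in [z] and below [q], hence equal to
    [q], and [t = 1] gives the superadditivity of [q]. *)
Theorem sublinear_majorizes_linear q0 : sublinear q0 ->
  exists2 L : V -> R, linear (L : V -> R^o) & forall x, L x <= q0 x.
Proof.
move=> /minimal_sublinear[q [sq qq0 qmin]]; exists q => //.
have [qD qZ] := sq.
have qZ_eq t x : 0 < t -> q (t *: x) = t * q x.
  move=> t0; apply/le_anti; rewrite qZ//=.
  have := qZ t^-1 (t *: x); rewrite invr_gt0 scalerA mulVf ?gt_eqF// scale1r.
  by move=> /(_ t0); rewrite -ler_pdivrMl ?invr_gt0// invrK.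
have qDr x y : q x + q y <= q (x + y).
  pose A z := [set q (z + t *: y) - t * q y | t in [set t | 0 <= t]].
  pose r z := inf (A z).
  have lbA z : lbound (A z) (- q (- z)).
    move=> _ [t /= t0 <-]; have := qD (z + t *: y) (- z).
    rewrite addrAC subrr add0r; have [->|tn0] := eqVneq t 0.
      by rewrite scale0r mul0r sublinear0// addr0; lra.
    by rewrite qZ_eq ?lt_neqAle 1?eq_sym ?tn0//; lra.
  have rle z t : 0 <= t -> r z <= q (z + t *: y) - t * q y.
    by move=> t0; apply: ge_inf; [exists (- q (- z))|exists t].
  have ler z a : (forall t, 0 <= t -> a <= q (z + t *: y) - t * q y) -> a <= r z.
    move=> h; apply: lb_le_inf; last by move=> _ [t t0 <-]; exact: h.
    by exists (q (z + 0 *: y) - 0 * q y), 0 => /=.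
  have sr : sublinear r.
    split=> [u v|s u s0].
      rewrite -lerBlDl; apply: (ler) => t t0; rewrite lerBlDl -lerBlDr.
      apply: (ler) => t' t'0; rewrite lerBlDr.
      rewrite (le_trans (rle _ (t' + t) _))// ?addr_ge0//.
      have := qD (u + t' *: y) (v + t *: y).
      by rewrite addrACA -scalerDl; lra.
    rewrite -ler_pdivrMl//; apply: (ler) => t t0; rewrite ler_pdivrMl//.
    rewrite (le_trans (rle _ (s * t) _))// ?mulr_ge0 ?(ltW s0)//.
    by rewrite -scalerA -scalerDr qZ_eq// mulrBr mulrA.
  have rq z : r z <= q z.
    by have := rle z 0 (lexx _); rewrite scale0r addr0 mul0r subr0.
  rewrite -lerBrDr -(qmin _ sr rq).
  by have := rle x 1 ler01; rewrite scale1r mul1r.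
have qDE x y : q (x + y) = q x + q y by apply/le_anti; rewrite qD qDr.
have qN x : q (- x) = - q x.
  by have := qDE x (- x); rewrite subrr sublinear0//; lra.
move=> a x y; rewrite qDE; congr (_ + _).
have [a0|a0|->] := ltgtP a 0.
- by rewrite -[a]opprK scaleNr qN qZ_eq ?oppr_gt0// -mulNr.
- exact: qZ_eq.
- by rewrite scale0r sublinear0// scale0r.
Qed.

End hahn_banach.

(** * Separation of a cone of bounded functions *)

Section bounded_functions.
Context (R : realType) (T : Type).

Definition bounded_function : {pred T -> R^o} :=
  fun f => `[< exists M, forall x, `|f x| <= M >].

Record bounded_fun := BoundedFun {
  bounded_fun_val :> T -> R^o ;
  bounded_fun_subproof : bounded_fun_val \in bounded_function }.

HB.instance Definition _ := [isSub for bounded_fun_val].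
HB.instance Definition _ := [Choice of bounded_fun by <:].

Lemma bounded_functionP (f : T -> R) :
  reflect (exists M, forall x, `|f x| <= M) (f \in bounded_function).
Proof. exact: asboolP. Qed.

Lemma bounded_function_submod : submod_closed bounded_function.
Proof.
split; first by apply/asboolP; exists 0 => x; rewrite normr0.
move=> a f g /asboolP[M fM] /asboolP[N gN]; apply/asboolP.
exists (`|a| * M + N) => x.
by rewrite (le_trans (ler_normD _ _))// lerD// normrM ler_wpM2l.
Qed.

HB.instance Definition _ := GRing.isSubmodClosed.Build R (T -> R^o)
  bounded_function bounded_function_submod.
HB.instance Definition _ := [SubChoice_isSubLmodule of bounded_fun by <:].

(** Hahn-Banach applied to [q f], the infimum of the [a] such that
    [f - g <= a] for some [g] in the cone [G].  The condition that no member
    of [G] is bounded below by a positive constant is what makes [q] finite: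
    it keeps these [a] above [- M] when [|f| <= M]. *)
Lemma cone_separation (G : set bounded_fun) :
  G 0 -> (forall f g, G f -> G g -> G (f + g)) ->
  (forall (t : R) g, 0 < t -> G g -> G (t *: g)) ->
  (forall (g : bounded_fun) e, G g -> 0 < e -> exists x, g x < e) ->
  exists L : bounded_fun -> R, [/\ linear (L : _ -> R^o),
    forall (f : bounded_fun) a, (forall x, f x <= a) -> L f <= a &
    forall g, G g -> L g <= 0].
Proof.
move=> G0 GD GZ Gneg.
pose A (f : bounded_fun) : set R :=
  [set a | exists2 g : bounded_fun, G g & forall x, f x - g x <= a].
pose q f := inf (A f).
have bnd (f : bounded_fun) : exists M, forall x, `|f x| <= M.
  by apply/asboolP; exact: bounded_fun_subproof.
have A0 f : A f !=set0.
  have [M fM] := bnd f; exists M, 0 => // x.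
  by rewrite subr0 (le_trans (ler_norm _)).
have lbA (f : bounded_fun) M a : (forall x, `|f x| <= M) -> A f a -> - M <= a.
  move=> fM [g Gg fga]; apply/ler_addgt0Pr => e e0.
  have [x gx] := Gneg _ _ Gg e0; have := fga x; have := fM x.
  by rewrite ler_norml => /andP[]; lra.
have qle f a : A f a -> q f <= a.
  move=> Afa; apply: ge_inf => //; have [M fM] := bnd f.
  by exists (- M) => b; exact: lbA.
have qge f b : (forall a, A f a -> b <= a) -> b <= q f by exact: lb_le_inf.
have [|L linL Lq] := @sublinear_majorizes_linear R bounded_fun q.
  split=> [f g|t f t0].
    rewrite -lerBlDl; apply: (qge) => a [g1 Gg1 ga]; rewrite lerBlDl -lerBlDr.
    apply: (qge) => b [f1 Gf1 fb]; rewrite lerBlDr; apply: qle.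
    exists (f1 + g1); first exact: GD.
    move=> x; have := ga x; have := fb x.
    by rewrite -[(f + g) x]/(f x + g x) -[(f1 + g1) x]/(f1 x + g1 x); lra.
  rewrite -ler_pdivrMl//; apply: (qge) => a [g Gg fa]; rewrite ler_pdivrMl//.
  apply: qle; exists (t *: g) => [|x]; first exact: GZ.
  by rewrite -mulrBr ler_pM2l.
exists L; split => // [f a fa|g Gg]; apply: le_trans (Lq _) _; apply: qle.
  by exists 0 => // x; rewrite subr0.
by exists g => // x; rewrite subrr.
Qed.

End bounded_functions.

(** * From finitely additive to regular probabilities *)

(** The construction below follows the Riesz representation theorem, but starts
    from a finitely additive [lam] on all subsets: open sets are measured by
    [lam] on the closed sets inside them, arbitrary sets by the open sets around
    them.  Finite additivity alone makes open sets Caratheodory measurable, and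
    countable subadditivity comes from compactness. *)
Section finitely_additive_to_regular.
Context (R : realType) (T : ptopologicalType).
Variable lam : set T -> R.
Hypothesis T_compact : compact [set: T].
Hypothesis T_hausdorff : hausdorff_space T.
Hypothesis lam_ge0 : forall A, 0 <= lam A.
Hypothesis lamU : forall A B, A `&` B = set0 -> lam (A `|` B) = lam A + lam B.
Hypothesis lamT : lam setT = 1.

Let lam0 : lam set0 = 0.
Proof. by have := lamU (setI0 set0); rewrite setU0; lra. Qed.

Let le_lam A B : A `<=` B -> lam A <= lam B.
Proof.
move=> AB; have -> : B = A `|` (B `\` A).
  by rewrite setDE setUIr setUCr setIT setUidr.
by rewrite lamU ?lerDl// setDE setICA setICr setI0.
Qed.

Let lamU_le A B : lam (A `|` B) <= lam A + lam B.
Proof.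
have -> : A `|` B = A `|` (B `\` A) by rewrite setDE setUIr setUCr setIT.
rewrite lamU ?setDE 1?setICA ?setICr ?setI0// lerD2l.
by apply: le_lam => x [].
Qed.

Local Open Scope ereal_scope.

Definition closed_inner (O : set T) : \bar R :=
  ereal_sup [set (lam C)%:E | C in [set C | closed C /\ C `<=` O]].

Definition open_outer (A : set T) : \bar R :=
  ereal_inf [set closed_inner O | O in [set O | open O /\ A `<=` O]].

Let closed_inner_ge O C : closed C -> C `<=` O -> (lam C)%:E <= closed_inner O.
Proof. by move=> cC CO; apply: ereal_sup_ubound; exists C. Qed.

Let closed_inner_le O (a : \bar R) :
  (forall C, closed C -> C `<=` O -> (lam C)%:E <= a) -> closed_inner O <= a.
Proof. by move=> h; apply: ge_ereal_sup => _ [C [cC CO] <-]; exact: h. Qed.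

Let closed_inner_ge0 O : 0 <= closed_inner O.
Proof.
by rewrite -[0]/(0%R%:E) -lam0; apply: closed_inner_ge => //; exact: closed0.
Qed.

Let le_closed_inner O P : O `<=` P -> closed_inner O <= closed_inner P.
Proof.
move=> OP; apply: closed_inner_le => C cC CO.
by apply: closed_inner_ge => //; exact: subset_trans OP.
Qed.

Let open_outer_le A O : open O -> A `<=` O -> open_outer A <= closed_inner O.
Proof. by move=> opO AO; apply: ereal_inf_lbound; exists O. Qed.

Let open_outer_ge A (a : \bar R) :
  (forall O, open O -> A `<=` O -> a <= closed_inner O) -> a <= open_outer A.
Proof. by move=> h; apply: le_ereal_inf_tmp => _ [V [oV AV] <-]; exact: h. Qed.

Let open_outer_open O : open O -> open_outer O = closed_inner O.
Proof.
move=> oO; apply/eqP; rewrite eq_le; apply/andP; split.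
  exact: open_outer_le.
by apply: open_outer_ge => P _; exact: le_closed_inner.
Qed.

Let open_outer_ge0 A : 0 <= open_outer A.
Proof. by apply: open_outer_ge => O _ _; exact: closed_inner_ge0. Qed.

Let le_open_outer A B : A `<=` B -> open_outer A <= open_outer B.
Proof.
move=> AB; apply: open_outer_ge => O oO BO.
by apply: open_outer_le => //; exact: subset_trans BO.
Qed.

Let open_outerT : open_outer setT = 1.
Proof.
rewrite (open_outer_open openT); apply/eqP; rewrite eq_le; apply/andP; split.
  by apply: closed_inner_le => C _ _; rewrite lee_fin -lamT le_lam.
by rewrite -[1]/(1%R%:E) -lamT; apply: closed_inner_ge => //; exact: closedT.
Qed.

Let open_outer0 : open_outer set0 = 0.
Proof.
apply/le_anti; rewrite open_outer_ge0 andbT (open_outer_open open0).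
by apply: closed_inner_le => C _; rewrite subset0 => ->; rewrite lam0.
Qed.

Let open_outer_fin A : open_outer A \is a fin_num.
Proof.
rewrite ge0_fin_numE// (le_lt_trans (@le_open_outer _ setT _))//.
by rewrite open_outerT ltry.
Qed.

Let open_outer_adherent A (e : R) : (0 < e)%R ->
  exists O, [/\ open O, A `<=` O & closed_inner O <= open_outer A + e%:E].
Proof.
move=> e0; have [_ [V [oV AV] <-] /ltW h] :=
  lb_ereal_inf_adherent e0 (open_outer_fin A).
by exists V.
Qed.

Let lam_le_open_outer C : closed C -> (lam C)%:E <= open_outer C.
Proof. by move=> cC; apply: open_outer_ge => O _; exact: closed_inner_ge. Qed.

(** By normality, the part of [C] outside [B] has a closed neighbourhood
    contained in [A]; it and the rest of [C] are the two pieces. *)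
Let closed_split (C A B : set T) :
  closed C -> open A -> open B -> C `<=` A `|` B ->
  exists C1 C2 : set T,
    [/\ closed C1, closed C2, C1 `<=` A, C2 `<=` B & C `<=` C1 `|` C2].
Proof.
move=> cC oA oB CAB.
have cCB : closed (C `&` ~` B) by apply: closedI => //; exact: open_closedC.
have [|N nN NA] := @compact_normal T T_hausdorff T_compact _ cCB A.
  move=> x [Cx nBx]; apply: open_nbhs_nbhs; split => //.
  by have [] := CAB x Cx.
exists (closure N), (C `&` ~` N°); split => //.
- exact: closed_closure.
- by apply: closedI => //; apply: open_closedC; exact: open_interior.
- move=> x [Cx nNx]; apply: contrapT => nBx; apply: nNx.
  exact: nN.
- move=> x Cx; have [Nx|nNx] := pselect (N° x); last by right.
  by left; apply: subset_closure; exact: interior_subset.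
Qed.

Let lam_le_sum (O : (set T)^nat) N C : (forall n, open (O n)) -> closed C ->
  C `<=` \big[setU/set0]_(i < N) O i ->
  (lam C)%:E <= \sum_(i < N) closed_inner (O i).
Proof.
move=> oO; elim: N C => [|N IH] C cC.
  by rewrite !big_ord0 subset0 => ->; rewrite lam0.
rewrite !big_ord_recr/= => CO.
have [|C1 [C2 [cC1 cC2 C1O C2O CC]]] := closed_split cC _ (oO N) CO.
  by elim/big_ind: _ => //; [exact: open0|exact: openU].
rewrite (@le_trans _ _ ((lam C1)%:E + (lam C2)%:E))//.
  by rewrite -EFinD lee_fin (le_trans (le_lam CC)).
by rewrite leeD ?IH// closed_inner_ge.
Qed.

Let closed_inner_bigcup (O : (set T)^nat) : (forall n, open (O n)) ->
  closed_inner (\bigcup_n O n) <= \sum_(n <oo) closed_inner (O n).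
Proof.
move=> oO; apply: closed_inner_le => C cC CO.
have : compact C by exact: (subclosed_compact cC T_compact).
rewrite compact_cover => /(_ _ setT O (fun n _ => oO n) CO)[D _ CD].
pose N := (\max_(i <- enum_fset D) i)%N.+1.
have CN : C `<=` \big[setU/set0]_(i < N) O i.
  move=> x /CD[i /= iD Oix]; rewrite -bigcup_mkord; exists i => //=.
  by rewrite ltnS; exact: leq_bigmax_seq.
rewrite (le_trans (lam_le_sum oO cC CN))//.
rewrite -(big_mkord xpredT (closed_inner \o O)).
by apply: nneseries_lim_ge => n _ _; exact: closed_inner_ge0.
Qed.

Let open_outer_sigma_subadditive : sigma_subadditive open_outer.
Proof.
move=> F; apply/lee_addgt0Pr => e e0.
have en n : (0 < e / (2 ^ n.+1)%:R)%R by rewrite divr_gt0// ltr0n expn_gt0.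
have /choice[W WP] n := open_outer_adherent (F n) (en n).
apply: (le_trans _
  (epsilon_trick xpredT (fun n => open_outer_ge0 (F n)) (ltW e0))).
rewrite (le_trans (@le_open_outer _ (\bigcup_n W n) _))//.
  by move=> x [n _ Fx]; exists n => //; have [_ + _] := WP n; exact.
rewrite open_outer_open; last by apply: bigcup_open => n _; have [] := WP n.
rewrite (le_trans (closed_inner_bigcup _))// => [n|]; first by have [] := WP n.
by apply: lee_nneseries => // n _; have [] := WP n.
Qed.

Let mu_ : {outer_measure set T -> \bar R} := HB.pack open_outer
  (isOuterMeasure.Build R T open_outer open_outer0 open_outer_ge0
    le_open_outer open_outer_sigma_subadditive).

(** For closed [C] inside [V `&` O] and closed [D] inside [V `\` C], the sets
    [C] and [D] are disjoint, so [lam C + lam D] is at most the measure of [V];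
    the supremum over [D] and then over [C] gives the inequality. *)
Let caratheodory_open O : open O -> mu_.-caratheodory O.
Proof.
move=> oO; apply: le_caratheodory_measurable => A /=.
apply: open_outer_ge => V oV AV.
apply: (@le_trans _ _ (open_outer (V `&` O) + open_outer (V `&` ~` O))).
  by apply: leeD; apply: le_open_outer; exact: setSI.
rewrite open_outer_open; last exact: openI.
rewrite -leeBrDr//; apply: closed_inner_le => C cC CVO.
rewrite leeBrDr// addeC -leeBrDr//.
have oVC : open (V `&` ~` C) by apply: openI => //; exact: closed_openC.
rewrite (le_trans (@open_outer_le _ _ oVC _))//.
  by move=> x [Vx nOx]; split => // /CVO[].
apply: closed_inner_le => D cD DVC; rewrite leeBrDr// -EFinD -lamU; last first.
  by rewrite -subset0 => x [Dx Cx]; have [_] := DVC x Dx.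
apply: closed_inner_ge; first exact: closedU.
by move=> x [/DVC[]|/CVO[]].
Qed.

Let measurable_caratheodory (A : set (borel T)) :
  measurable A -> mu_.-caratheodory A.
Proof.
move=> mA.
suff : (caratheodory_display mu_).-measurable
  (A : set (caratheodory_type mu_)) by [].
move: A mA; apply: smallest_sub; last exact: caratheodory_open.
exact: sigma_algebra_measurable.
Qed.

Let open_outer_sigma_additive :
  semi_sigma_additive (open_outer : set (borel T) -> \bar R).
Proof.
move=> F mF tF _.
apply: (@measure_semi_sigma_additive _ (caratheodory_type mu_) R mu_ F) => //.
- by move=> n; exact: measurable_caratheodory.
- by apply: bigcup_measurable => n _; exact: measurable_caratheodory.
Qed.

Let mu_borel : {measure set (borel T) -> \bar R} :=
  HB.pack (open_outer : set (borel T) -> \bar R)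
    (isMeasure.Build _ (borel T) R open_outer open_outer0 open_outer_ge0
      open_outer_sigma_additive).

Let mu : probability (borel T) R :=
  HB.pack (Measure.sort mu_borel)
    (Measure_isProbability.Build _ (borel T) R mu_borel open_outerT).

(** [mu] need not extend [lam], but on closed sets it can only be larger, as
    every open neighbourhood is measured from the closed sets inside it.  Inner
    regularity is outer regularity of the complement, closed sets being compact
    here. *)
Theorem regular_probability_ge : exists2 mu : probability (borel T) R,
  regular_measure mu & forall C, closed C -> (lam C)%:E <= mu C.
Proof.
exists mu; last exact: lam_le_open_outer.
move=> A mA; split; apply/eqP; rewrite eq_le; apply/andP; split.
- by apply: le_ereal_inf_tmp => _ [V [oV AV] <-]; exact: le_open_outer.
- apply: open_outer_ge => O oO AO; apply: ereal_inf_lbound; exists O => //.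
  exact: open_outer_open.
- apply/lee_addgt0Pr => e e0.
  have [W [oW AW We]] := open_outer_adherent (~` A) e0.
  have cW : closed (~` W) by exact: open_closedC.
  have mW : measurable (W : set (borel T)) by exact: sub_sigma_algebra.
  apply: (@le_trans _ _ (mu (~` W) + e%:E)); last first.
    rewrite leeD2r//; apply: ereal_sup_ubound; exists (~` W) => //; split.
      exact: (subclosed_compact cW T_compact).
    by move=> x nWx; apply: contrapT => nAx; exact/nWx/AW.
  rewrite probability_setC// -[X in X + _]addeC.
  move: We; rewrite -open_outer_open// -[open_outer W]/(mu W).
  rewrite -[open_outer (~` A)]/(mu (~` A)) probability_setC//.
  have fA : mu A \is a fin_num by exact: open_outer_fin.
  have fW : mu W \is a fin_num by exact: open_outer_fin.
  rewrite -(fineK fA) -(fineK fW).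
  rewrite -!EFinB -!EFinD lee_fin => We'.
  rewrite -[leLHS]/(mu A) -(fineK fA) lee_fin.
  by move: (fine (mu A)) (fine (mu W)) We' => a w; lra.
- by apply: ge_ereal_sup => _ [K [cK KA] <-]; exact: le_open_outer.
Qed.

End finitely_additive_to_regular.

(** * Measures dominating a functional *)

(** The sum is [d] times the number of levels [d, 2 d, .., N d] below [a], so it
    approximates [a] from below with error at most [d] as long as [a] does not
    exceed the top level. *)
Lemma staircase_bounds (R : realType) (d a : R) (N : nat) : 0 <= a -> 0 < d ->
  let s := \sum_(i < N) d * (i.+1%:R * d <= a)%R%:R in
  s <= a /\ (a <= N%:R * d -> a <= d + s).
Proof.
move=> a0 d0 s.
suff [h1 h2 _] : [/\ s <= a, (a <= N%:R * d -> a <= d + s) &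
    (N%:R * d <= a -> s = N%:R * d)] by [].
rewrite {}/s; elim: N => [|N [IH1 IH2 IH3]].
  by rewrite big_ord0 mul0r; split => //; lra.
rewrite big_ord_recr/=; set s := \sum_(i < N) _ in IH1 IH2 IH3 *.
have [le|lt] := leP (N.+1%:R * d) a.
  have := le; rewrite -natr1 mulrDl mul1r => le'.
  rewrite IH3 ?mulr1; last by lra.
  by split=> //; lra.
rewrite mulr0 addr0; split=> // _.
have [/IH2//|] := leP a (N%:R * d).
by move=> /ltW/IH3 ->; move: lt; rewrite -natr1 mulrDl mul1r; lra.
Qed.

Lemma continuous_borel_measurable (R : realType) (T : ptopologicalType)
  (f : T -> R) : continuous f -> measurable_fun setT (f : borel T -> R).
Proof.
move=> cf; apply: (measurability _ (RGenOpens.measurableE R)).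
move=> _ [_ [a [b ->] <-]]; rewrite setTI; apply: sub_sigma_algebra.
by move/continuousP: cf; apply; exact: interval_open.
Qed.

Section dominating_measure.
Context (R : realType) (T : ptopologicalType).
Hypothesis T_compact : compact [set: T].
Hypothesis T_hausdorff : hausdorff_space T.

Lemma indic_bounded (A : set T) : (\1_A : T -> R^o) \in @bounded_function R T.
Proof.
apply/bounded_functionP; exists 1 => x; rewrite indicE.
by case: (_ \in _); rewrite ?normr1 ?normr0.
Qed.

Definition bounded_indic A : bounded_fun R T := BoundedFun (indic_bounded A).

(** The layer cake formula: up to [d], the function [f] is the sum of [d] times
    the indicators of its superlevel sets, which are closed, and on closed sets
    the measure dominates the finitely additive [L \o bounded_indic]. *)
Lemma functional_le_integral (L : bounded_fun R T -> R) :
  linear (L : _ -> R^o) ->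
  (forall (f : bounded_fun R T) a, (forall x, f x <= a) -> L f <= a) ->
  exists2 mu : probability (borel T) R, regular_measure mu &
    forall f : bounded_fun R T,
      continuous (f : T -> R) -> (forall x, 0 <= f x) ->
      ((L f)%:E <= \int[mu]_x (f x)%:E)%E.
Proof.
move=> linL Lle.
have LD f g : L (f + g) = L f + L g.
  by have := linL 1 f g; rewrite !scale1r.
have L0 : L 0 = 0 by have := LD 0 0; rewrite addr0; lra.
have LZ a f : L (a *: f) = a * L f.
  by have := linL a f 0; rewrite L0 !addr0.
have LN f : L (- f) = - L f by rewrite -scaleN1r LZ mulN1r.
have L1 : L (bounded_indic setT) = 1.
  apply/le_anti/andP; split; first by apply: Lle => x; rewrite /= indicT.
  rewrite -lerN2 -LN; apply: Lle => x.
  by rewrite -[(- _ : bounded_fun R T) x]/(- \1_setT x) indicT.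
have [|A B AB||mu mu_reg mu_ge] :=
  regular_probability_ge T_compact T_hausdorff
    (lam := L \o bounded_indic) => //=.
- move=> A; rewrite -oppr_le0 -LN; apply: Lle => x.
  by rewrite -[(- _ : bounded_fun R T) x]/(- \1_A x) oppr_le0 indicE.
- rewrite -LD; congr (L _); apply/val_inj/funext => x /=.
  rewrite -[RHS]/(\1_A x + \1_B x) !indicE in_setU.
  have : ~ (A x /\ B x) by rewrite -[_ /\ _]/((A `&` B) x) AB.
  case: (boolP (x \in A)) => [/set_mem Ax|_];
    case: (boolP (x \in B)) => [/set_mem Bx|_].
  + by case.
  + by rewrite addr0.
  + by rewrite add0r.
  + by rewrite addr0.
exists mu => // f cf f0.
have [M fM] : exists M, forall x, `|f x| <= M.
  by apply/bounded_functionP; exact: bounded_fun_subproof.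
apply/lee_addgt0Pr => d d0.
(* enough levels for the top one to exceed f *)
pose N := (Num.truncn (M / d)).+1.
have MN : M <= N%:R * d.
  by rewrite -ler_pdivrMr// ltW// truncnS_gt.
pose F (i : nat) := [set x | i.+1%:R * d <= f x].
have cF i : closed (F i).
  apply: (@closed_comp _ _ (f : T -> R) [set y | i.+1%:R * d <= y]);
    last exact: closed_ge.
  by move=> x _; exact: cf.
have mF i : measurable (F i : set (borel T)).
  rewrite -[F i]setCK; apply: measurableC; apply: sub_sigma_algebra.
  exact: closed_openC.
pose s x := \sum_(i < N) d * \1_(F i) x.
have sE x : s x = \sum_(i < N) d * (i.+1%:R * d <= f x)%R%:R.
  by apply: eq_bigr => i _; rewrite indicE/= mem_setE.
have ms : measurable_fun setT (fun x : borel T => (s x)%:E).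
  apply/measurable_EFinP; apply: measurable_sum => i.
  by apply: measurable_funM => //; exact: measurable_indic.
apply: (@le_trans _ _ (\int[mu]_x (s x)%:E + d%:E)%E); last first.
  rewrite leeD2r//; apply: ge0_le_integral => //.
  - by move=> x _; rewrite lee_fin sumr_ge0// => i _; rewrite mulr_ge0// ltW.
  - by apply/measurable_EFinP; exact: continuous_borel_measurable.
  - by move=> x _; rewrite lee_fin sE; have [] := staircase_bounds N (f0 x) d0.
have -> : (\int[mu]_x (s x)%:E = \sum_(i < N) d%:E * mu (F i))%E.
  under eq_integral do rewrite -sumEFin.
  rewrite ge0_integral_sum//.
  - apply: eq_bigr => i _; under eq_integral do rewrite EFinM.
    rewrite ge0_integralZl_EFin//; last 2 first.
      by apply/measurable_EFinP; exact: measurable_indic.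
      exact: ltW.
    by rewrite integral_indic// setIT.
  - move=> i; apply/measurable_EFinP.
    by apply: measurable_funM => //; exact: measurable_indic.
  - by move=> i x _; rewrite lee_fin mulr_ge0// ltW.
have Ls : L f - \sum_(i < N) d * L (bounded_indic (F i)) <= d.
  under eq_bigr do rewrite -LZ.
  rewrite -(big_morph L LD L0) -LN -LD.
  apply: Lle => x.
  set g := \sum_(i < N) _.
  have gx : g x = s x.
    pose ev (h : bounded_fun R T) : R := h x.
    have evD : {morph ev : h k / h + k >-> h + k} by [].
    by rewrite -[g x]/(ev g) /g (big_morph ev evD erefl).
  rewrite -[(f - g) x]/(f x - g x) gx sE lerBlDr.
  have [_] := staircase_bounds N (f0 x) d0; apply.
  by rewrite (le_trans _ MN)// (le_trans (ler_norm _))//.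
apply: (@le_trans _ _
  (\sum_(i < N) d%:E * (L (bounded_indic (F i)))%:E + d%:E)%E).
  by under eq_bigr do rewrite -EFinM; rewrite sumEFin -EFinD lee_fin; lra.
rewrite leeD2r//; apply: lee_sum => i _; rewrite lee_pmul2l//.
exact: mu_ge.
Qed.

(** Pietsch's argument: the functional separating [G] from the positive
    constants is [<= 0] at [s - f], so its value at [f], and a fortiori the
    integral of [f], is at least [s]. *)
Theorem cone_dominating_measure (G : set (bounded_fun R T)) :
  G 0 -> (forall f g, G f -> G g -> G (f + g)) ->
  (forall (t : R) g, 0 < t -> G g -> G (t *: g)) ->
  (forall (g : bounded_fun R T) e, G g -> 0 < e -> exists x, g x < e) ->
  exists2 mu : probability (borel T) R, regular_measure mu &
    forall (s : R) (f : T -> R), continuous f -> (forall x, 0 <= f x) ->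
      (exists2 g : bounded_fun R T, G g & forall x, g x = s - f x) ->
      (s%:E <= \int[mu]_x (f x)%:E)%E.
Proof.
move=> G0 GD GZ Gneg.
have [L [linL Lle LG]] := cone_separation G0 GD GZ Gneg.
have [mu mu_reg mu_ge] := functional_le_integral linL Lle.
exists mu => // s f cf f0 [g Gg gE].
pose k := - s *: bounded_indic setT; pose h := - (g + k).
have hE : h = f :> (T -> R).
  apply/funext => x.
  rewrite -[h x]/(- (g x + - s * \1_setT x)) gE indicT/=; lra.
have := mu_ge h; rewrite hE => /(_ cf f0); apply: le_trans; rewrite lee_fin.
have L0 : L 0 = 0 by have := linL 1 0 0; rewrite !scale1r addr0; lra.
have Lgk : L (g + k) = L g + L k by have := linL 1 g k; rewrite !scale1r.
have : L h + L (g + k) = 0.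
  by have := linL 1 h (g + k); rewrite !scale1r addNr L0.
have := LG _ Gg; have : L k <= - s.
  by apply: Lle => x; rewrite -[k x]/(- s * \1_setT x) indicT/= mulr1.
by rewrite Lgk; lra.
Qed.

End dominating_measure.

(** * Bounded operators and uniform boundedness *)

Section operator_bounds.
Context (R : realType) (V W : normedModType R).

Lemma operator_norm_apply (f : operator V W) x : `|f x| <= `|f| * `|x|.
Proof.
have [->|x0] := eqVneq x 0; first by rewrite linear0 !normr0 mulr0.
have nx0 : 0 < `|x| by rewrite normr_gt0.
rewrite -ler_pdivrMr// mulrC -[X in X * _]gtr0_norm ?invr_gt0//.
rewrite -normrZ -linearZ.
by apply: operator_norm_ub; rewrite normrZ normfV normr_id mulVf ?gt_eqF.
Qed.

Lemma bounded_is_operator (f : V -> W) M :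
  linear f -> (forall x, `|f x| <= M * `|x|) -> f \in @is_operator R V W.
Proof.
move=> lf fM; apply/is_operatorP; split => //.
pose F : {linear V -> W} := HB.pack f (GRing.isLinear.Build _ _ _ _ _ lf).
apply: (@bounded_linear_continuous R V W F).
apply/linear_boundedP; near=> r => x; rewrite (le_trans (fM x))// ler_wpM2r//.
Unshelve. all: by end_near. Qed.

End operator_bounds.

Section operator_complete.
Context (R : realType) (V : normedModType R) (W : completeNormedModType R).

(** The limit is taken pointwise.  An [f0] that is [e]-close to most operators
    of the filter is, pointwise on the unit ball, [e]-close to the limit; this
    yields both the boundedness of the limit and the convergence in norm. *)
Lemma operator_cauchy_cvg (F : set_system (operator V W)) :
  ProperFilter F -> cauchy F -> cvg F.
Proof.
move=> FF /cauchyP cF.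
have near_op e : 0 < e ->
    exists f0 : operator V W, \forall f \near F, `|f0 - f| < e.
  by move=> /cF[f0 /= Ff0]; exists f0; move: Ff0; rewrite -ball_normE.
have cvgx x : cvg ((fun f : operator V W => f x) @ F).
  apply: cauchy_cvg; apply: cauchy_exP => e e0.
  have x1 : 0 < `|x| + 1 by rewrite ltr_wpDl.
  have [f0 Ff0] := near_op _ (divr_gt0 e0 x1).
  exists (f0 x); apply: filterS Ff0 => f Ff.
  rewrite -ball_normE /ball_/=.
  rewrite -[f0 x - f x]/((f0 - f) x) (le_lt_trans (operator_norm_apply _ _))//.
  rewrite (@le_lt_trans _ _ (`|f0 - f| * (`|x| + 1)))//.
    by rewrite ler_wpM2l// lerDl.
  by rewrite -ltr_pdivlMr.
pose g x : W := lim ((fun f : operator V W => f x) @ F).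
have gP x : (fun f : operator V W => f x) @ F --> g x by exact: cvgx.
have g_close e (f0 : operator V W) x : (\forall f \near F, `|f0 - f| <= e) ->
    `|f0 x - g x| <= e * `|x|.
  move=> f0e; have : (fun f : operator V W => f0 x - f x) @ F --> f0 x - g x.
    by apply: cvgB => //; exact: cvg_cst.
  move=> /cvg_norm; apply: (@closed_cvg _ _ _ _
    (fun f : operator V W => `|f0 x - f x|) [set y | y <= e * `|x|]).
    exact: closed_le.
  apply: filterS f0e => f f0f; rewrite /= -[f0 x - f x]/((f0 - f) x).
  by rewrite (le_trans (operator_norm_apply _ _))// ler_wpM2r.
have linear_g : linear g.
  move=> a x y.
  apply: (@cvg_unique _ (@norm_hausdorff _ W) _ _ _ _ (gP (a *: x + y))) => /=.
  rewrite (_ : (fun f => _) = (fun f : operator V W => a *: f x + f y)).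
    by apply: cvgD; [exact: (cvgZl_tmp (gP x))|exact: gP].
  by apply/funext => f; exact: operator_linear.
have [f1 Ff1] := near_op 1 ltr01.
have g_op : g \in @is_operator R V W.
  apply: (@bounded_is_operator _ _ _ _ (`|f1| + 1)) => // x.
  rewrite -[g x](subrK (f1 x)) (le_trans (ler_normD _ _))// addrC mulrDl.
  rewrite lerD ?operator_norm_apply// distrC; apply: g_close.
  by apply: filterS Ff1 => f /ltW.
apply/cvg_ex; exists (Operator g_op : operator V W).
apply/cvgrPdist_le => e e0.
have e20 : 0 < e / 2 by rewrite divr_gt0.
have [f0 Ff0] := near_op _ e20.
have f0g : `|f0 - Operator g_op| <= e / 2.
  apply: operator_norm_le => x x1; rewrite -[(f0 - _) x]/(f0 x - g x).
  rewrite (@le_trans _ _ (e / 2 * `|x|))//; last by rewrite ler_piMr// ltW.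
  by apply: g_close; apply: filterS Ff0 => f /ltW.
apply: filterS Ff0 => f /ltW f0f; rewrite distrC.
rewrite -[f](subrK f0) -addrA (le_trans (ler_normD _ _))// [leRHS]splitr.
by rewrite lerD// distrC.
Qed.

HB.instance Definition _ :=
  Uniform_isComplete.Build (operator V W) operator_cauchy_cvg.

End operator_complete.

Section uniform_boundedness.
Context (R : realType) (X Y : normedModType R).

(** The uniform boundedness principle, whose domain is here the dual of [X]:
    a space of operators into the complete space of scalars. *)
Lemma sot_cvg_bounded (T_ : (operator (dual X) Y)^nat)
    (T : operator (dual X) Y) :
  sot_cvg T_ T -> exists M, forall n f, `|f| <= 1 -> `|T_ n f| <= M.
Proof.
move=> cT.
pose F : set (operator X R^o -> Y) := [set (T_ n : _ -> _) | n in setT].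
have [||M MP] := @Banach_Steinhauss R (operator X R^o) Y F _ _ 1.
- move=> _ [n _ <-]; split; last exact: operator_linear.
  move=> r; exists (`|T_ n| * r) => x xr.
  by rewrite (le_trans (operator_norm_apply _ _))// ler_wpM2l.
- move=> f; have /cvg_seq_bounded/pinfty_ex_gt0[M _ TM] := cvgP _ (cT f).
  by exists M => _ [n _ <-]; exact: TM.
by exists M => n f f1; apply: MP => //; exists n.
Qed.

End uniform_boundedness.

(** * The weak-star compact dual ball *)

Section dual_ball_compact.
Context (R : realType) (X : normedModType R).

Lemma ball_val_norm (f : dual_ball X) : `|ball_val f| <= 1.
Proof. by have := set_valP f. Qed.

Lemma ball_val_apply (f : dual_ball X) x : `|(ball_val f x : R)| <= `|x|.
Proof.
rewrite (le_trans (operator_norm_apply _ _))//.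
by rewrite ler_piMl// ball_val_norm.
Qed.

Lemma dual_ball_intro (f : dual X) : `|f| <= 1 ->
  exists g : dual_ball X, ball_val g = f.
Proof. by move=> f1; exists (exist _ (f : weak_star X) (mem_set f1)). Qed.

Lemma continuous_ball_eval (x : X) :
  continuous (fun f : dual_ball X => ball_val f x : R).
Proof.
move=> f; have /dual_ball_cvgP : nbhs f --> f by exact: cvg_refl.
exact.
Qed.

Lemma dual_ball_hausdorff : hausdorff_space (dual_ball X).
Proof.
rewrite open_hausdorff => f g fg.
have [x fgx] : exists x, (ball_val f x : R) != ball_val g x.
  apply: contrapT => /forallNP h; move/eqP: fg; apply.
  apply: val_inj; apply/operatorP => x; apply/eqP.
  by apply: contrapT => /negP; exact: h.
have := @Rhausdorff R; rewrite open_hausdorff => /(_ _ _ fgx).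
move=> [[A B] /= [Af Bg] [oA oB AB]].
pose e (h : dual_ball X) : R := ball_val h x.
exists (e @^-1` A, e @^-1` B) => /=.
  by split; apply: mem_set => /=; exact: set_mem.
split.
- by apply: open_comp => // y _; exact: continuous_ball_eval.
- by apply: open_comp => // y _; exact: continuous_ball_eval.
- by rewrite -preimage_setI (eqP AB) preimage_set0.
Qed.

(** The Banach-Alaoglu theorem by ultrafilters: along an ultrafilter, each
    evaluation stays in a segment and therefore converges, and the pointwise
    limit inherits linearity and the bound on the norm. *)
Lemma dual_ball_compact : compact [set: dual_ball X].
Proof.
rewrite compact_ultra => F FU _.
have FF : ProperFilter F by exact: ultra_proper.
have /choice[l lP] x : exists l : R,
    (fun f : dual_ball X => ball_val f x : R) @ F --> l /\ `|l| <= `|x|.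
  pose e (f : dual_ball X) : R := ball_val f x.
  have Fx : F (e @^-1` `[- `|x|, `|x|]%classic).
    apply: (@filterE _ F) => f; rewrite /= in_itv/= -ler_norml.
    exact: ball_val_apply.
  have [l [lx lF]] := @segment_compact R (- `|x|) `|x| (e @ F) _ Fx.
  exists l; split; last by rewrite ler_norml; move: lx; rewrite /= in_itv.
  move=> A nA; have [//|nFA] := in_ultra_setVsetC (e @^-1` A) FU.
  by have [r []] := lF (~` A) A nFA nA.
have l_unique x (a : R) :
    (fun f : dual_ball X => ball_val f x : R) @ F --> a -> l x = a.
  by move=> Fa; apply: (@cvg_unique _ (@Rhausdorff R) _ _ _ _ (lP x).1 Fa).
have lin : linear (l : X -> R^o).
  move=> a x y; apply: l_unique.
  rewrite (_ : (fun f => _) = (fun f : dual_ball X =>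
      a * (ball_val f x : R) + (ball_val f y : R))).
    by apply: cvgD; [apply: cvgMl_tmp; exact: (lP x).1|exact: (lP y).1].
  by apply/funext => f; exact: operator_linear.
have l_op : (l : X -> R^o) \in @is_operator R X R^o.
  apply: (@bounded_is_operator _ _ _ _ 1) => // x.
  by rewrite mul1r; exact: (lP x).2.
have [g gE] : exists g : dual_ball X, ball_val g = Operator l_op.
  apply: dual_ball_intro; apply: operator_norm_le => x x1.
  by rewrite (le_trans (lP x).2).
exists g; split => //=; apply/dual_ball_cvgP => x.
by rewrite gE; exact: (lP x).1.
Qed.

End dual_ball_compact.

(** * Strong measurability *)

Section strong_measurability.
Context (R : realType).

Lemma continuous_norm_powR (Y : normedModType R) (p : R) : 0 < p ->
  continuous (fun y : Y => `|y| `^ p).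
Proof.
move=> p0 x; have pn0 : p != 0 by rewrite gt_eqF.
have [->|x0] := eqVneq x 0.
  rewrite /continuous_at normr0 powR0//; apply/cvgrPdist_lt => e e0.
  near=> y; rewrite sub0r normrN ger0_norm ?powR_ge0//.
  rewrite -[ltRHS](powRr1 (ltW e0)) -(mulVf pn0) powRrM.
  rewrite gt0_ltr_powR ?nnegrE ?powR_ge0//.
  near: y; apply/nbhs_normP; exists (e `^ p^-1); first exact: powR_gt0.
  by move=> y /=; rewrite sub0r normrN.
apply: (@continuous_comp Y R R (fun y : Y => `|y|) (fun y => y `^ p) x).
  exact: norm_continuous.
apply: differentiable_continuous; apply/derivable1_diffP.
by apply: derivable_powR; rewrite in_itv/= andbT normr_gt0.
Unshelve. all: by end_near. Qed.

Context (T : ptopologicalType) (mu : {measure set (borel T) -> \bar R}).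

(** Each level set of [s] is a Borel set up to a null set; off the finitely many
    null sets, [phi \o s] is the combination of the indicators of these Borel
    sets. *)
Lemma mu_simple_ae_measurable (Y : normedModType R) (s : T -> Y)
    (phi : Y -> R) :
  mu_simple mu s -> exists2 g : borel T -> R, measurable_fun setT g &
    {ae mu, forall x, phi (s x) = g x}.
Proof.
move=> [/finite_fsetP[D rangeD] sA].
have /choice[A /choice[N AN]] y : exists A N, [/\
    measurable (A : set (borel T)), mu.-negligible (N : set (borel T)) &
    A `|` N = s @^-1` [set y]].
  by have [A mA [N nN AN]] := sA y; exists A, N.
exists (fun x => \sum_(y <- enum_fset D) phi y * \1_(A y) x).
  apply: measurable_sum => y; apply: measurable_funM => //.
  by apply: measurable_indic; have [] := AN y.
have : {ae mu, forall x, (\bigcap_(y in [set` D]) ~` N y) x}.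
  apply: filter_bigI => y _; have [_ nN _] := AN y.
  by apply: negligibleS nN => x /contrapT.
apply: filterS => x xN.
have sxD : s x \in D by have : range s (s x) by []; rewrite rangeD.
have iA y : y \in D -> (x \in A y) = (y == s x).
  move=> yD; have [_ _ ANy] := AN y.
  have sxy : (s x = y) <-> (A y `|` N y) x by rewrite ANy.
  apply/idP/eqP => [/set_mem Ayx|ysx]; first by apply/esym/sxy; left.
  by apply: mem_set; case: (sxy.1 (esym ysx)) => // Nyx; case: (xN _ yD).
rewrite (bigD1_seq (s x))//= ?fset_uniq// big1_seq ?addr0.
  by rewrite indicE iA// eqxx mulr1.
by move=> y /andP[ysx yD]; rewrite indicE iA// (negbTE ysx) mulr0.
Qed.

(** A Borel version of [|f|^p], through which integrals for the completion of
    [mu] become integrals of Borel functions; the limit superior of Borel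
    versions of the [|s_n|^p] is one.  The outer absolute value only makes it
    nonnegative on the exceptional null set. *)
Lemma strongly_measurable_norm_powR (Y : normedModType R) (f : T -> Y) (p : R) :
  0 < p -> strongly_measurable mu f ->
  exists g : borel T -> \bar R, [/\ measurable_fun setT g,
    forall x, (0 <= g x)%E & {ae mu, forall x, (`|f x| `^ p)%:E = g x}].
Proof.
move=> p0 [s s_simple s_cvg].
have /choice[g gP] n : exists g : borel T -> R, measurable_fun setT g /\
    {ae mu, forall x, `|s n x| `^ p = g x}.
  have [g mg gs] := mu_simple_ae_measurable (fun y => `|y| `^ p) (s_simple n).
  by exists g.
exists (fun x => `|limn_esup (fun n => (g n x)%:E)|)%E; split => //.
  apply: measurableT_comp => //; apply: measurable_fun_limn_esup => n.
  by apply/measurable_EFinP; have [] := gP n.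
have gs : {ae mu, forall x, forall n, `|s n x| `^ p = g n x}.
  by apply: ae_foralln => n; have [] := gP n.
have := @filterS2 _ _ (ae_filter_ringOfSetsType mu) _ _ _ _ s_cvg gs; apply.
move=> x sx gx.
have : (g n x)%:E @[n --> \oo] --> (`|f x| `^ p)%:E.
  apply/cvg_EFin; first exact: nearW.
  under [X in X @ _]eq_fun do rewrite /= -gx.
  exact: (cvg_comp _ _ sx (@continuous_norm_powR Y p p0 (f x))).
by move=> /cvg_limn_einf_sup[_ ->]; rewrite gee0_abs// lee_fin powR_ge0.
Qed.

End strong_measurability.

(** * Integrals of norms of operators *)

Section strong_norm_integral.
Context (R : realType) (X Y : normedModType R) (p : R).
Hypothesis p_gt0 : 0 < p.
Variable mu : probability (borel (dual_ball X)) R.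

(** The [p]-th power of the [L^p(mu)] seminorm that controlled operators are
    bounded by. *)
Definition strong_normp (T : operator (dual X) Y) : \bar R :=
  (\int[mu]_(f in [set: borel (dual_ball X)]) (`|T (ball_val f)| `^ p)%:E)%E.

Let smeas (T : operator (dual X) Y) :=
  strongly_measurable mu (fun f : dual_ball X => T (ball_val f)).

Lemma strong_normp_sum_le n (T_ : 'I_n -> operator (dual X) Y) (M : R) :
  (forall i, smeas (T_ i)) ->
  (forall f : dual X, `|f| <= 1 -> \sum_(i < n) `|T_ i f| `^ p <= M) ->
  (\sum_(i < n) strong_normp (T_ i) <= M%:E)%E.
Proof.
move=> mT TM.
have /choice[g gP] i := strongly_measurable_norm_powR p_gt0 (mT i).
have -> : (\sum_(i < n) strong_normp (T_ i) = \int[mu]_x \sum_(i < n) g i x)%E.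
  rewrite ge0_integral_sum//; last 2 first.
  - by move=> i; have [] := gP i.
  - by move=> i x _; have [] := gP i.
  apply: eq_bigr => i _; have [mg g0 Tg] := gP i.
  by apply: ge0_completed_integralE => // x; rewrite lee_fin powR_ge0.
have -> : M%:E = (\int[mu]_(x in [set: borel (dual_ball X)]) (cst M%:E x))%E.
  rewrite integral_cst// [X in (_ * X)%E](_ : _ = 1%E) ?mule1//.
  exact: probability_setT.
apply: ae_ge0_le_integral => //.
- by move=> x _; apply: sume_ge0 => i _; have [] := gP i.
- by apply: emeasurable_sum => i; have [] := gP i.
- move=> x _; rewrite lee_fin (le_trans _ (TM 0 _)) ?normr0//.
  by apply: sumr_ge0 => i _; exact: powR_ge0.
have Tg : {ae mu, forall x, forall i, (`|T_ i (ball_val x)| `^ p)%:E = g i x}.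
  by apply: filter_forall => i; have [] := gP i.
have := @filterS _ _ (ae_filter_ringOfSetsType mu) _ _ _ Tg; apply.
move=> x gx _; under eq_bigr do rewrite -gx.
by rewrite sumEFin lee_fin; apply: TM; exact: ball_val_norm.
Qed.

(** Dominated convergence: by the uniform boundedness principle a constant
    dominates the whole sequence. *)
Lemma sot_cvg_strong_normp (T_ : (operator (dual X) Y)^nat)
    (T : operator (dual X) Y) :
  (forall n, smeas (T_ n)) -> smeas T -> sot_cvg T_ T ->
  strong_normp (T_ n) @[n --> \oo] --> strong_normp T.
Proof.
move=> mT_ mT TT.
have [M TM] := sot_cvg_bounded TT.
have /choice[g_ gP_] n := strongly_measurable_norm_powR p_gt0 (mT_ n).
have [g [mg g0 Tg]] := strongly_measurable_norm_powR p_gt0 mT.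
have Tg_ : {ae mu, forall x, forall n, (`|T_ n (ball_val x)| `^ p)%:E = g_ n x}.
  by apply: ae_foralln => n; have [] := gP_ n.
rewrite (_ : (fun n => _) = (fun n => \int[mu]_x g_ n x)%E); last first.
  apply/funext => n; have [mgn gn0 Tgn] := gP_ n.
  by apply: ge0_completed_integralE => // x; rewrite lee_fin powR_ge0.
rewrite (_ : strong_normp T = \int[mu]_x g x)%E; last first.
  by apply: ge0_completed_integralE => // x; rewrite lee_fin powR_ge0.
have [|||||_ _] := @dominated_convergence _ _ R mu setT measurableT g_ g
  (cst (M `^ p)%:E).
- by move=> n; have [] := gP_ n.
- exact: mg.
- have := @filterS2 _ _ (ae_filter_ringOfSetsType mu) _ _ _ _ Tg_ Tg; apply.
  move=> x gnx gx _; rewrite -gx.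
  rewrite (_ : g_ ^~ x = (fun n => (`|T_ n (ball_val x)| `^ p)%:E)).
    apply/cvg_EFin; first exact: nearW.
    exact: (cvg_comp _ _ (TT (ball_val x))
      (@continuous_norm_powR R Y p p_gt0 (T (ball_val x)))).
  by apply/funext => n; rewrite -gnx.
- exact: finite_measure_integrable_cst.
- have := @filterS _ _ (ae_filter_ringOfSetsType mu) _ _ _ Tg_; apply.
  move=> x gnx n _; rewrite -gnx gee0_abs ?lee_fin ?powR_ge0//.
  have Tn := TM n (ball_val x) (ball_val_norm x).
  have M0 : 0 <= M by exact: le_trans Tn.
  by apply: ge0_ler_powR; rewrite ?nnegrE//; exact: ltW.
exact.
Qed.

End strong_norm_integral.

(** * Summing and controlled operators *)

Section summing_and_controlled.
Context (R : realType) (p : R) (X Y Z : normedModType R).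
Context (U : set (operator (dual X) Y)) (S : operator (dual X) Y -> Z).
Hypothesis p_ge1 : 1 <= p.
Hypothesis U0 : U 0.
Hypothesis U_lin : forall (a : R) T V, U T -> U V -> U (a *: T + V).
Hypothesis U_meas : U `<=` universally_measurable X Y.
Hypothesis S_lin : forall (a : R) T V, U T -> U V ->
  S (a *: T + V) = a *: S T + S V.

Let p_gt0 : 0 < p. Proof. exact: lt_le_trans p_ge1. Qed.
Let p_neq0 : p != 0. Proof. by rewrite gt_eqF. Qed.

Let powRK (a : R) : 0 <= a -> (a `^ p^-1) `^ p = a.
Proof. by move=> a0; rewrite -powRrM mulVf// powRr1. Qed.

Let powRVK (a : R) : 0 <= a -> (a `^ p) `^ p^-1 = a.
Proof. by move=> a0; rewrite -powRrM mulfV// powRr1. Qed.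

Let ler_powRp (a b : R) : 0 <= a -> a <= b -> a `^ p <= b `^ p.
Proof.
move=> a0 ab; apply: ge0_ler_powR; rewrite ?nnegrE ?(ltW p_gt0)//.
exact: le_trans ab.
Qed.

Let ler_powRVp (a b : R) : 0 <= a -> a <= b -> a `^ p^-1 <= b `^ p^-1.
Proof.
move=> a0 ab; apply: ge0_ler_powR; rewrite ?nnegrE ?invr_ge0 ?(ltW p_gt0)//.
exact: le_trans ab.
Qed.

Let S0 : S 0 = 0.
Proof.
have := S_lin 1 U0 U0; rewrite !scale1r addr0 => h.
by apply: (addrI (S 0)); rewrite addr0 -h.
Qed.

Let UZ (a : R) T : U T -> U (a *: T).
Proof. by move=> UT; rewrite -[_ *: _]addr0; exact: U_lin. Qed.

Let SZ (a : R) T : U T -> S (a *: T) = a *: S T.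
Proof. by move=> UT; rewrite -[a *: T]addr0 S_lin// S0 addr0. Qed.

Definition strong_sum n (T_ : 'I_n -> operator (dual X) Y) (f : dual X) : R :=
  \sum_(i < n) `|T_ i f| `^ p.

Let strong_sum_ge0 n (T_ : 'I_n -> operator (dual X) Y) f :
  0 <= strong_sum T_ f.
Proof. by apply: sumr_ge0 => i _; exact: powR_ge0. Qed.

Definition strong_sup n (T_ : 'I_n -> operator (dual X) Y) : R :=
  sup [set strong_sum T_ f `^ p^-1 | f in [set f : dual X | `|f| <= 1]].

Lemma strong_sum_le_sup n (T_ : 'I_n -> operator (dual X) Y) f :
  `|f| <= 1 -> strong_sum T_ f `^ p^-1 <= strong_sup T_.
Proof.
move=> f1; apply: sup_ubound; last by exists f.
exists ((\sum_(i < n) `|T_ i| `^ p) `^ p^-1) => _ [g /= g1 <-].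
apply: ler_powRVp => //; apply: ler_sum => i _; apply: ler_powRp => //.
by rewrite (le_trans (operator_norm_apply _ _))// ler_piMr.
Qed.

Lemma strong_sup_le n (T_ : 'I_n -> operator (dual X) Y) (M : R) :
  (forall f, `|f| <= 1 -> strong_sum T_ f `^ p^-1 <= M) -> strong_sup T_ <= M.
Proof.
move=> TM; apply: ge_sup; last by move=> _ [f /= f1 <-]; exact: TM.
by exists (strong_sum T_ 0 `^ p^-1), 0 => //=; rewrite normr0.
Qed.

Lemma strong_normp_fin (mu : probability (borel (dual_ball X)) R) T :
  regular_measure mu -> U T ->
  exists2 r : R, 0 <= r & strong_normp p mu T = r%:E.
Proof.
move=> mu_reg UT.
have I0 : (0 <= strong_normp p mu T)%E.
  by apply: integral_ge0 => x _; rewrite lee_fin powR_ge0.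
have : (strong_normp p mu T <= (`|T| `^ p)%:E)%E.
  have -> : strong_normp p mu T = (\sum_(i < 1) strong_normp p mu T)%E.
    by rewrite big_ord1.
  apply: strong_normp_sum_le => // [_|f f1]; first exact: U_meas.
  rewrite big_ord1; apply: ler_powRp => //.
  by rewrite (le_trans (operator_norm_apply _ _))// ler_piMr.
case: (strong_normp p mu T) I0 => // r; rewrite lee_fin => r0 _.
by exists r.
Qed.

Lemma controlled_powR (K a : R) (r : R) : 0 <= K -> 0 <= a -> 0 <= r ->
  ((a%:E <= K%:E * r%:E `^ p^-1)%E <-> a `^ p <= K `^ p * r).
Proof.
move=> K0 a0 r0; rewrite poweR_EFin -EFinM lee_fin; split=> h.
  by rewrite -[r in leRHS]powRK// -powRM ?powR_ge0// ler_powRp.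
by rewrite -[a]powRVK// -[K]powRVK// -powRM ?powR_ge0// ler_powRVp ?powR_ge0.
Qed.

(** Integrate the pointwise bound on [|T_1 f|^p + .. + |T_n f|^p]. *)
Lemma controlled_summing : controlled p U S -> summing p U S.
Proof.
move=> [K K0 [mu mu_reg Smu]]; exists K => // n T_ UT.
rewrite -/(strong_sup T_).
have sup0 : 0 <= strong_sup T_.
  by rewrite (le_trans _ (@strong_sum_le_sup _ T_ 0 _)) ?powR_ge0// normr0.
have /choice[r rP] i : exists r : R, 0 <= r /\ strong_normp p mu (T_ i) = r%:E.
  by have [r] := strong_normp_fin mu_reg (UT i); exists r.
rewrite -(powRVK (mulr_ge0 K0 sup0)); apply: ler_powRVp.
  by apply: sumr_ge0 => i _; exact: powR_ge0.
apply: (@le_trans _ _ (\sum_(i < n) K `^ p * r i)).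
  apply: ler_sum => i _; have [r0 rE] := rP i.
  by apply/controlled_powR => //; rewrite -rE; exact: Smu.
rewrite -mulr_sumr powRM// ler_wpM2l ?powR_ge0// -lee_fin -sumEFin.
under eq_bigr do rewrite -(rP _).2.
apply: strong_normp_sum_le => //; first by move=> i; exact: U_meas.
move=> f f1; rewrite -[leLHS]powRK ?strong_sum_ge0//.
by rewrite ler_powRp ?powR_ge0 ?strong_sum_le_sup.
Qed.

(** By linearity this concerns [T_ n - T], whose integrals tend to [0]. *)
Lemma controlled_sot_continuous :
  controlled p U S -> sot_sequentially_continuous U S.
Proof.
move=> [K K0 [mu mu_reg Smu]] T_ T UT_ UT TT.
pose D n := T_ n - T.
have UD n : U (D n) by rewrite /D addrC -scaleN1r; exact: U_lin.
have SD n : S (D n) = S (T_ n) - S T.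
  by rewrite /D addrC -scaleN1r S_lin// scaleN1r addrC.
have D0 : sot_cvg D 0.
  move=> f; rewrite -[X in _ --> X](subrr (T f)).
  by apply: cvgB; [exact: TT|exact: cvg_cst].
have norm0 : strong_normp p mu (0 : operator (dual X) Y) = 0%E.
  apply: integral0_eq => x _.
  by rewrite -[(0 : operator _ _) _]/(0 : Y) normr0 powR0.
have := sot_cvg_strong_normp p_gt0 (fun n => U_meas (UD n) mu_reg)
  (U_meas U0 mu_reg) D0.
rewrite norm0 => /fine_cvgP[_] /= Dcvg.
apply/cvgrPdist_lt => e e0.
have : (K `^ p * fine (strong_normp p mu (D n))) @[n --> \oo] --> K `^ p * 0.
  by apply: cvgMl_tmp; exact: Dcvg.
rewrite mulr0 => /cvgrPdist_lt/(_ (e `^ p) (powR_gt0 _ e0)).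
apply: filterS => n; have [r r0 rE] := strong_normp_fin mu_reg (UD n).
rewrite rE /= sub0r normrN ger0_norm ?mulr_ge0 ?powR_ge0// => Kr.
rewrite distrC -SD ltNge; apply/negP => eS.
have : `|S (D n)| `^ p <= K `^ p * r.
  by apply/controlled_powR => //; rewrite -rE; exact: Smu.
apply/negP; rewrite -ltNge (lt_le_trans Kr)//.
by apply: ler_powRp => //; exact: ltW.
Qed.

(** These functions of [f] form the convex cone to separate from the positive
    constants; a measure with nonpositive integral on all of them is the
    dominating one. *)
Definition pietsch_gap (K : R) (s : seq (operator (dual X) Y))
    (f : dual X) : R :=
  \sum_(T <- s) (`|S T| `^ p - K `^ p * `|T f| `^ p).

(** If the gap were at least [e] on the whole ball, [K^p] times the strong sum
    would be at most [A - e] there, hence [K * strong_sup T_] at most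
    [(A - e)^(1/p)], which is less than [A^(1/p)]. *)
Lemma summing_pietsch_gap (K : R) : 0 <= K ->
  (forall n (T_ : 'I_n -> operator (dual X) Y), (forall i, U (T_ i)) ->
    (\sum_(i < n) `|S (T_ i)| `^ p) `^ p^-1 <= K * strong_sup T_) ->
  forall s e, (forall T, T \in s -> U T) -> 0 < e ->
  exists2 f : dual X, `|f| <= 1 & pietsch_gap K s f < e.
Proof.
move=> K0 Ssum s e sU e0; apply: contrapT => noneg.
pose T_ (i : 'I_(size s)) := tnth (in_tuple s) i.
have UT i : U (T_ i) by apply: sU; exact: mem_tnth.
pose A := \sum_(i < size s) `|S (T_ i)| `^ p.
have gapE f : pietsch_gap K s f = A - K `^ p * strong_sum T_ f.
  by rewrite /pietsch_gap big_tnth /A /strong_sum mulr_sumr -sumrB.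
have gap_ge f : `|f| <= 1 -> e <= pietsch_gap K s f.
  by move=> f1; rewrite leNgt; apply/negP => ?; apply: noneg; exists f.
have Ae f : `|f| <= 1 -> K `^ p * strong_sum T_ f <= A - e.
  by move=> /gap_ge; rewrite gapE; lra.
have Ae0 : 0 <= A - e.
  by rewrite (le_trans _ (Ae 0 _)) ?normr0// mulr_ge0 ?powR_ge0.
have Ksup : K * strong_sup T_ <= (A - e) `^ p^-1.
  have [->|Kn0] := eqVneq K 0; first by rewrite mul0r powR_ge0.
  have Kp : 0 < K by rewrite lt_neqAle eq_sym Kn0.
  rewrite -ler_pdivlMl//; apply: strong_sup_le => f f1.
  rewrite ler_pdivlMl// -[K in leLHS]powRVK// -powRM ?powR_ge0//.
  by apply: ler_powRVp; [rewrite mulr_ge0 ?powR_ge0|exact: Ae].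
have := le_trans (Ssum _ T_ UT) Ksup; apply/negP; rewrite -ltNge.
apply: gt0_ltr_powR; rewrite ?nnegrE ?invr_gt0//.
  by apply: sumr_ge0 => i _; exact: powR_ge0.
by rewrite -/A; lra.
Qed.

(** Continuity of [T] on the ball is what allows passing from the finitely
    additive separating functional to an integral. *)
Lemma summing_controlled_on_epsilon : summing p U S ->
  exists2 K : R, 0 <= K & exists2 mu : probability (borel (dual_ball X)) R,
    regular_measure mu & forall T, U T -> epsilon_product X Y T ->
      ((`|S T| `^ p)%:E <= (K `^ p)%:E * strong_normp p mu T)%E.
Proof.
move=> [K K0 Ssum]; exists K => //.
pose G := [set g : bounded_fun R (dual_ball X) |
  exists2 s, (forall T, T \in s -> U T) &
    forall f, g f = pietsch_gap K s (ball_val f)].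
have G0 : G 0 by exists nil => // f; rewrite /pietsch_gap big_nil.
have GD f g : G f -> G g -> G (f + g).
  move=> [s sU fs] [t tU gt]; exists (s ++ t) => [T|x].
    by rewrite mem_cat => /orP[/sU|/tU].
  by rewrite -[(f + g) x]/(f x + g x) fs gt /pietsch_gap big_cat.
have GZ (a : R) g : 0 < a -> G g -> G (a *: g).
  move=> a0 [s sU gs].
  (* the gap is homogeneous of degree p in the operators *)
  exists [seq (a `^ p^-1) *: T | T <- s] => [_ /mapP[T /sU UT ->]|x].
    exact: UZ.
  rewrite -[(a *: g) x]/(a * g x) gs /pietsch_gap big_map mulr_sumr.
  rewrite big_seq [RHS]big_seq; apply: eq_bigr => T /sU UT.
  rewrite SZ// -[(_ *: T) _]/(_ *: T (ball_val x)) !normrZ ger0_norm ?powR_ge0//.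
  by rewrite !powRM ?powR_ge0// powRK ?(ltW a0)// mulrBr [X in _ = _ - X]mulrCA.
have Gneg (g : bounded_fun R (dual_ball X)) e :
    G g -> 0 < e -> exists x, g x < e.
  move=> [s sU gs] e0; have [f f1 fe] := summing_pietsch_gap K0 Ssum sU e0.
  by have [x xf] := dual_ball_intro f1; exists x; rewrite gs xf.
have [mu mu_reg mu_ge] := cone_dominating_measure (@dual_ball_compact R X)
  (@dual_ball_hausdorff R X) G0 GD GZ Gneg.
exists mu => // T UT cT.
pose phi (f : dual_ball X) : R := K `^ p * `|T (ball_val f)| `^ p.
have phi0 f : 0 <= phi f by rewrite mulr_ge0 ?powR_ge0.
have cTp : continuous (fun f : dual_ball X => `|T (ball_val f)| `^ p).
  move=> f; apply: (@continuous_comp (dual_ball X) Y R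
    (fun f => T (ball_val f)) (fun y => `|y| `^ p) f); first exact: cT.
  exact: continuous_norm_powR.
have cphi : continuous phi.
  by move=> f; apply: (@cvgMl_tmp R _ _ _ _ _ _ (cTp f)).
have gap_bounded : (fun f => `|S T| `^ p - phi f : R^o)
    \in @bounded_function R (dual_ball X).
  apply/bounded_functionP; exists (`|S T| `^ p + K `^ p * `|T| `^ p) => f.
  rewrite (le_trans (ler_normB _ _))// !ger0_norm ?powR_ge0// lerD2l.
  rewrite ler_wpM2l ?powR_ge0// ler_powRp//.
  rewrite (le_trans (operator_norm_apply _ _))//.
  by rewrite ler_piMr// ball_val_norm.
have gapG : exists2 g : bounded_fun R (dual_ball X), G g &
    forall f, g f = `|S T| `^ p - phi f.
  exists (BoundedFun gap_bounded) => //; exists [:: T].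
    by move=> V; rewrite inE => /eqP ->.
  by move=> f; rewrite /pietsch_gap big_seq1.
apply: (le_trans (mu_ge _ _ cphi phi0 gapG)); rewrite /phi.
under eq_integral do rewrite EFinM.
rewrite ge0_integralZl_EFin ?powR_ge0//.
by apply/measurable_EFinP; exact: continuous_borel_measurable.
Qed.

(** Both sides of the domination inequality are sequentially continuous for the
    strong operator topology: the left one by hypothesis, the right one by
    dominated convergence. *)
Lemma dense_summing_controlled :
  sot_sequentially_dense (U `&` epsilon_product X Y) U ->
  summing p U S -> sot_sequentially_continuous U S -> controlled p U S.
Proof.
move=> [_ dense] /summing_controlled_on_epsilon[K K0 [mu mu_reg Smu]] cS.
exists K => //; exists mu => // T UT; rewrite -/(strong_normp p mu T).
have [r r0 rE] := strong_normp_fin mu_reg UT; rewrite rE.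
apply/controlled_powR => //.
have [T_ UT_ TT] := dense T UT.
have ST : `|S (T_ n)| `^ p @[n --> \oo] --> `|S T| `^ p.
  exact: (cvg_comp _ _ (cS T_ T (fun n => (UT_ n).1) UT TT)
    (@continuous_norm_powR R Z p p_gt0 (S T))).
have := sot_cvg_strong_normp p_gt0 (fun n => U_meas (UT_ n).1 mu_reg)
  (U_meas UT mu_reg) TT.
rewrite rE => /fine_cvgP[_] /= rcvg.
apply: (ler_cvg_to ST (cvgMl_tmp rcvg)); apply: nearW => n.
have [s s0 sE] := strong_normp_fin mu_reg (UT_ n).1.
by have := Smu _ (UT_ n).1 (UT_ n).2; rewrite /= sE -EFinM lee_fin.
Qed.

End summing_and_controlled.

Theorem theorem2p9 (R : realType) (p : R) (X Y Z : completeNormedModType R)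
    (U : set (operator (dual X) Y)) (S : operator (dual X) Y -> Z) :
  1 <= p -> closed_subspace U -> U `<=` universally_measurable X Y ->
  operator_on U S ->
  (controlled p U S -> summing p U S /\ sot_sequentially_continuous U S) /\
  (sot_sequentially_dense (U `&` epsilon_product X Y) U ->
    (controlled p U S <-> summing p U S /\ sot_sequentially_continuous U S)).
Proof.
move=> p1 [_ U0 U_lin] U_meas [S_lin _].
have i_ii : controlled p U S -> summing p U S /\ sot_sequentially_continuous U S.
  move=> cS; split; first exact: (controlled_summing p1 U_meas).
  exact: (controlled_sot_continuous p1 U0 U_lin U_meas S_lin).
split=> // dense; split=> // -[sS cS].
exact: (dense_summing_controlled p1 U0 U_lin U_meas S_lin).
Qed.
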